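(* For every integer $k\ge 0$, there are infinitely many positive integers $n$ that iterate to the fixed point $12\cdot 5^k$; that is, infinitely many positive integers $n$ for which there exists a positive integer $j$ with $z^j(n)=12\cdot 5^k$.
   Context: The Fibonacci sequence is defined by $F_0=0$, $F_1=1$, $F_n=F_{n-1}+F_{n-2}$ for $n\ge 2$. For a positive integer $n$, the order of appearance $z(n)$ is the smallest positive integer $\ell$ such that $n\mid F_\ell$ (it exists for every $n \geq 1$). For $j\ge 1$, $z^j(n)$ denotes the $j$-th iterate of $z$ applied to $n$ (so $z^1(n)=z(n)$ and $z^{j+1}(n)=z(z^j(n))$). A fixed point is a positive integer $n$ with $z(n)=n$. It is known that the fixed points are exactly the integers $5^k$ and $12\cdot 5^k$ with $k\ge 0$. *)

(* Defs.v *)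
From mathcomp Require Import all_boot.
From mathcomp Require Import classical_sets cardinality.

Set Implicit Arguments.
Unset Strict Implicit.
Unset Printing Implicit Defensive.

Fixpoint fib (n : nat) : nat :=
  match n with
  | 0 => 0
  | 1 => 1
  | (m.+1 as p).+1 => fib p + fib m
  end.

Lemma fibSS n : fib n.+2 = fib n.+1 + fib n.
Proof. by []. Qed.

(* The pairs (F_i mod n, F_(i+1) mod n) repeat, and the recurrence can be run
   backwards, so the pair (F_0, F_1) itself recurs. *)
Lemma fib_dvd_exists n : 0 < n -> exists l, (0 < l) && (n %| fib l).
Proof.
case: n => // n _.
pose f (i : 'I_(n.+1 * n.+1).+1) : 'I_n.+1 * 'I_n.+1 :=
  (inord (fib i %% n.+1), inord (fib i.+1 %% n.+1)).
have /injectivePn[i [j neq_ij eq_f]] : ~~ injectiveb f.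
  apply/negP=> /injectiveP/leq_card.
  by rewrite card_prod !card_ord ltnn.
wlog lt_ij : i j neq_ij eq_f / i < j.
  move=> H; have := neq_ij; rewrite -val_eqE neq_ltn => /orP[] lt.
    exact: (H i j).
  by apply: (H j i) => //; rewrite eq_sym.
have [e1 e2] : fib i = fib j %[mod n.+1] /\ fib i.+1 = fib j.+1 %[mod n.+1].
  case: eq_f => /(congr1 val) /= + /(congr1 val) /=.
  by rewrite !inordK ?ltn_pmod.
exists (j - i); rewrite subn_gt0 lt_ij /=.
have key d : forall a, fib a = fib (a + d) %[mod n.+1] ->
    fib a.+1 = fib (a + d).+1 %[mod n.+1] -> n.+1 %| fib d.
  elim=> [|a IHa] h1 h2; first by rewrite /dvdn -h1 mod0n.
  apply: IHa; last exact: h1.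
  by apply/eqP; move/eqP: h2; rewrite addSn !fibSS -modnDml h1 modnDml eqn_modDl.
by apply: (key _ i); rewrite subnKC ?(ltnW lt_ij).
Qed.

(* Order of appearance. The value at 0, where no positive index exists, is a
   convention. *)
Definition z (n : nat) : nat :=
  if n is m.+1 then ex_minn (fib_dvd_exists (ltn0Sn m)) else 0.

Lemma zP n : 0 < n ->
  [/\ 0 < z n, n %| fib (z n) & forall l, 0 < l -> n %| fib l -> z n <= l].
Proof.
case: n => // n _ /=; case: ex_minnP => m /andP[m_gt0 dvd_m] m_min.
by split=> // l l_gt0 dvd_l; apply: m_min; rewrite l_gt0.
Qed.

(* Main.v *)
Require Import Defs.
From mathcomp Require Import all_boot.
From mathcomp Require Import classical_sets cardinality.

(** For m >= 3 the number F_m is larger than all earlier Fibonacci numbers, so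
    z(F_m) = m. Hence z^j undoes j applications of F, and since F_m > m for
    m >= 6, the numbers F(F(... F(12 * 5^k))) are pairwise distinct and all
    iterate to 12 * 5^k. *)

Local Open Scope classical_set_scope.

Lemma fib_gt0 n : 0 < n -> 0 < fib n.
Proof.
elim: n => [|[|n] IHn] // _.
by rewrite fibSS addn_gt0 IHn.
Qed.

Lemma fib_ltS n : 1 < n -> fib n < fib n.+1.
Proof.
case: n => [|[|n]] // _.
by rewrite [fib n.+3]fibSS -[ltnLHS]addn0 ltn_add2l fib_gt0.
Qed.

(** Only the larger index is bounded below: the sole failure of strictness is F_1 = F_2, at
    [n = 2]. *)
Lemma fib_lt m n : 2 < n -> m < n -> fib m < fib n.
Proof.
elim: n => // n IHn n_gt1; rewrite ltnS leq_eqVlt => /predU1P[->|lt_mn].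
  exact: fib_ltS.
have [n_gt2|n_le2] := ltnP 2 n.
  exact: ltn_trans (IHn n_gt2 lt_mn) (fib_ltS _ n_gt1).
have n2 : n = 2 by apply/eqP; rewrite eqn_leq n_le2.
by rewrite n2 in lt_mn *; case: m lt_mn {IHn} => [|[|m]].
Qed.

(** The bound is sharp, since F_5 = 5. *)
Lemma ltn_fib n : 5 < n -> n < fib n.
Proof.
elim: n => // n IHn; rewrite ltnS leq_eqVlt => /predU1P[<- //|n_gt5].
by apply: leq_ltn_trans (IHn n_gt5) (fib_ltS _ (ltn_trans _ n_gt5)).
Qed.

(** A smaller index would give a positive Fibonacci number below F_m, which F_m cannot divide. *)
Lemma z_fib m : 2 < m -> z (fib m) = m.
Proof.
move=> m_gt2; have m_gt0 : 0 < m by apply: ltn_trans m_gt2.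
have [z_gt0 dvd_z z_min] := zP (fib_gt0 _ m_gt0).
apply/eqP; rewrite eqn_leq z_min //= leqNgt; apply/negP=> /(fib_lt _ _ m_gt2).
by rewrite ltnNge dvdn_leq ?fib_gt0.
Qed.

Lemma iter_fib_gt5 j m : 5 < m -> 5 < iter j fib m.
Proof.
by move=> m_gt5; elim: j => //= j IHj; apply: ltn_trans IHj (ltn_fib _ IHj).
Qed.

Lemma iter_z_fib j m : 5 < m -> iter j z (iter j fib m) = m.
Proof.
move=> m_gt5; elim: j => // j IHj.
(* The innermost [z] cancels the outermost [fib]. *)
by rewrite iterSr iterS z_fib // (ltn_trans _ (iter_fib_gt5 j _ m_gt5)).
Qed.

Lemma iter_fib_inj m : 5 < m -> injective (fun j => iter j fib m).
Proof.
move=> m_gt5; apply: incn_inj; apply: leq_mono; apply: homo_ltn.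
  exact: ltn_trans.
by move=> j; apply/ltn_fib/iter_fib_gt5.
Qed.

Theorem theorem1p4 (k : nat) :
  infinite_set
    [set n : nat | 0 < n /\ exists j : nat, 0 < j /\ iter j z n = 12 * 5 ^ k].
Proof.
have m_gt5 : 5 < 12 * 5 ^ k.
  by apply: (@leq_trans 12) => //; rewrite leq_pmulr ?expn_gt0.
set S := [set n | _] => finS; apply: infinite_nat.
(* The shift to [j.+1] supplies the positive iteration count that [S] demands. *)
have inj_u : injective (fun j => iter j.+1 fib (12 * 5 ^ k)).
  by move=> i j /(iter_fib_inj _ m_gt5) [].
(* The preimage of [S] under this injection is all of [nat], so a finite [S] would make [nat]
   finite. *)
apply: sub_finite_set (finite_preimage (in2W inj_u) finS) => j _ /=.
split; first exact: ltn_trans (iter_fib_gt5 j.+1 _ m_gt5).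
by exists j.+1; split=> //; apply: iter_z_fib.
Qed.
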